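(* Let $(X,d)$ be a metric space, $F:X\to[0,+\infty]$, and $x:[0,\infty)\to X$. Let $z\in\mathrm{zer}F$ and $b>0$ with $d(x(t),z)\leq b$ for all $t\geq0$, and assume that $F$ has a modulus of regularity $\tau$ w.r.t. $\overline{B}_b(z)$. Let $G,H:[0,\infty)\to[0,\infty)$ and $g,h:(0,\infty)\to(0,\infty)$ be such that for all $a\geq0$, $\varepsilon>0$: \[ a<g(\varepsilon)\to G(a)<\varepsilon\quad\text{and}\quad H(a)<h(\varepsilon)\to a<\varepsilon. \] Assume $\varphi:(0,\infty)\times\mathbb{N}\to\mathbb{N}$ satisfies $\forall\varepsilon>0\ \forall n\in\mathbb{N}\ \exists t\in[n,\varphi(\varepsilon,n)]\ (F(x(t))<\varepsilon)$. Let $e$ be a real-valued function of pairs $0\leq s\leq t$ such that \[ \forall y\in\mathrm{zer}F\ \forall t\geq s\geq 0\ \left(H(d(x(t),y))\leq G(d(x(s),y))+e(s,t)\right), \] and such that $e(s,t)\to0$ as $s\leq t\to\infty$ with (natural-number valued) rate of metastability $\eta$, i.e. \[ \forall\varepsilon>0\ \forall f:\mathbb{N}\to\mathbb{N}\ \exists n\leq\eta(\varepsilon,f)\ \forall s\leq t\in[n,n+f(n)]\ (|e(s,t)|<\varepsilon). \] Then \[ \forall\varepsilon>0\ \forall f:\mathbb{N}\to\mathbb{N}\ \exists n\leq\rho(\varepsilon,f)\ \forall t\in[n,n+f(n)]\ (\mathrm{dist}(x(t),\mathrm{zer}F)<\varepsilon) \] and \[ \forall\varepsilon>0\ \forall f:\mathbb{N}\to\mathbb{N}\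 \exists n\leq\rho(\varepsilon/2,f)\ \forall s,t\in[n,n+f(n)]\ (d(x(t),x(s))<\varepsilon), \] where \[ \rho(\varepsilon,f):=\max\{\varphi(\tau(g(h(\varepsilon)/2)),n)\mid n\leq\eta(h(\varepsilon)/2,f_{\varphi,h(\varepsilon)})\}+1, \] \[ f_{\varphi,\delta}(n):=\max\{m+1+f(m+1)\mid m\leq\varphi(\tau(g(\delta/2)),n)\}\dot{-}n. \]
   Context: $\mathbb{N}$ contains $0$, and $n\dot{-}m:=\max\{n-m,0\}$; indices inside $\max$ range over natural numbers. $\mathrm{zer}F:=\{y\in X\mid F(y)=0\}$ and $\overline{B}_r(z):=\{y\in X\mid d(z,y)\leq r\}$. For $z\in\mathrm{zer}F$ and $r>0$, a modulus of regularity for $F$ w.r.t. $\overline{B}_r(z)$ is a function $\tau:(0,\infty)\to(0,\infty)$ such that for all $\varepsilon>0$ and all $u\in\overline{B}_r(z)$: $F(u)<\tau(\varepsilon)$ implies $\mathrm{dist}(u,\mathrm{zer}F)<\varepsilon$. *)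

(* Defs.v *)
From HB Require Import structures.
From mathcomp Require Import all_boot all_order all_algebra.
From mathcomp Require Import all_classical all_reals all_analysis.

Set Implicit Arguments.
Unset Strict Implicit.
Unset Printing Implicit Defensive.

Import Order.TTheory GRing.Theory Num.Theory.

Local Open Scope classical_set_scope.
Local Open Scope ring_scope.

(* A function with domain [0, +oo[ or ]0, +oo[ is a total function on R,
   constrained (and applied) only on that domain; likewise a function of pairs
   0 <= s <= t is a total function R -> R -> R. *)

Definition zer (R : realType) (X : metricType R) (F : X -> \bar R) : set X :=
  [set y | F y = 0%E].

(* Not the library's [closed_ball], which is the closure of the open ball and
   can be strictly smaller in a general metric space. *)
Definition cball (R : realType) (X : metricType R) (z : X) (r : R) : set X :=
  [set y | mdist z y <= r].

(* Extended-real valued, so that dist u set0 = +oo. *)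
Definition dist (R : realType) (X : metricType R) (u : X) (A : set X) : \bar R :=
  ereal_inf [set (mdist u y)%:E | y in A].

Definition modulus_of_regularity (R : realType) (X : metricType R)
    (F : X -> \bar R) (z : X) (r : R) (tau : R -> R) : Prop :=
  (forall eps : R, 0 < eps -> 0 < tau eps) /\
  (forall eps : R, 0 < eps -> forall u : X, cball z r u ->
    (F u < (tau eps)%:E)%E -> (dist u (zer F) < eps%:E)%E).

Definition metastability_rate (R : realType) (e : R -> R -> R)
    (eta : R -> (nat -> nat) -> nat) : Prop :=
  forall (eps : R) (f : nat -> nat), 0 < eps ->
    exists2 n : nat, (n <= eta eps f)%N &
      forall s t : R, n%:R <= s -> s <= t -> t <= (n + f n)%:R ->
        `|e s t| < eps.

Definition f_phi (R : realType) (g tau : R -> R) (phi : R -> nat -> nat)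
    (f : nat -> nat) (delta : R) (n : nat) : nat :=
  ((\max_(m < (phi (tau (g (delta / 2)%R)) n).+1) (m.+1 + f m.+1)) - n)%N.

Definition rho (R : realType) (g h tau : R -> R) (phi : R -> nat -> nat)
    (eta : R -> (nat -> nat) -> nat) (eps : R) (f : nat -> nat) : nat :=
  ((\max_(n < (eta (h eps / 2)%R (f_phi g tau phi f (h eps))).+1)
     phi (tau (g (h eps / 2)%R)) n) + 1)%N.

(* Main.v *)
Require Import Defs.
From HB Require Import structures.
From mathcomp Require Import all_boot all_order all_algebra.
From mathcomp Require Import all_classical all_reals all_analysis.

Set Implicit Arguments.
Unset Strict Implicit.
Unset Printing Implicit Defensive.

Import Order.TTheory GRing.Theory Num.Theory.

Local Open Scope classical_set_scope.
Local Open Scope ring_scope.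

(** The limit of the trajectory is never constructed; everything rests on a
    single zero of [F] that serves a whole window of times.  Fix [eps] and [f],
    and put [delta := h eps].  Metastability of the error, applied to the
    counterfunction [f_phi], yields a window starting at some [n0] on which
    [`|e|] stays below [delta / 2].  By the bound [phi] the trajectory visits,
    at some time [t0] between [n0] and [phi (tau (g (delta / 2))) n0], a point
    where [F] is below [tau (g (delta / 2))]; regularity turns this into a
    genuine zero [y] of [F] with [mdist (x t0) y < g (delta / 2)].  The
    quasi-Fejer inequality started at [t0] then gives
      [H (mdist (x t) y) <= G (mdist (x t0) y) + e t0 t < delta]
    for all later [t] in the window, that is, [mdist (x t) y < eps].

    What remains is that the time [t0] is real whereas the conclusion asks for
    a natural number: the new window starts at the first integer [n] after
    [t0], and [f_phi] is defined as a maximum over all possible values of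
    [n - 1] precisely so that [[t0, n + f n]] fits in the window of the error.

    This is [exists_zer_near_window].  Both claims are corollaries: a nearby
    zero bounds the distance to [zer F], and, since the same zero serves all
    times of the window, two points of the window are close to each other by
    the triangle inequality. *)

Lemma dist_ltP (R : realType) (X : metricType R) (u : X) (A : set X) (r : R) :
  (dist u A < r%:E)%E <-> exists2 y, A y & mdist u y < r.
Proof.
split=> [/ereal_inf_lt[_ [y Ay <-]]|[y Ay uy]].
  by rewrite lte_fin; exists y.
rewrite (@le_lt_trans _ _ (mdist u y)%:E) ?lte_fin//.
by apply: ereal_inf_lbound; exists y.
Qed.

(** Why the counterfunction [f_phi] is a maximum: it makes the window at [n]
    long enough for [f], whichever integer up to the bound [phi] turns out to
    be the starting point. *)
Lemma leq_f_phi (R : realType) (g tau : R -> R) (phi : R -> nat -> nat)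
    (f : nat -> nat) (delta : R) (n m : nat) :
  (m <= phi (tau (g (delta / 2))) n)%N ->
  (m.+1 + f m.+1 <= n + f_phi g tau phi f delta n)%N.
Proof.
rewrite -ltnS -leq_subLR => m_lt; apply: leq_sub2r.
exact: (leq_bigmax (Ordinal m_lt)).
Qed.

Lemma phi_lt_rho (R : realType) (g h tau : R -> R) (phi : R -> nat -> nat)
    (eta : R -> (nat -> nat) -> nat) (eps : R) (f : nat -> nat) (n : nat) :
  (n <= eta (h eps / 2) (f_phi g tau phi f (h eps)))%N ->
  (phi (tau (g (h eps / 2))) n < rho g h tau phi eta eps f)%N.
Proof.
rewrite /rho addn1 ltnS -ltnS => n_lt.
exact: (leq_bigmax (Ordinal n_lt)).
Qed.

(** One zero [y] serves the whole window; this uniformity is what makes the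
    points of the window close to each other, not only to [zer F]. *)
Lemma exists_zer_near_window (R : realType) (X : metricType R)
    (F : X -> \bar R) (x : R -> X) (z : X) (b : R)
    (x_bounded : forall t : R, 0 <= t -> mdist (x t) z <= b)
    (tau : R -> R) (tau_modulus : modulus_of_regularity F z b tau)
    (G H g h : R -> R)
    (g_gt0 : forall eps : R, 0 < eps -> 0 < g eps)
    (h_gt0 : forall eps : R, 0 < eps -> 0 < h eps)
    (G_modulus : forall a eps : R, 0 <= a -> 0 < eps -> a < g eps -> G a < eps)
    (H_modulus : forall a eps : R, 0 <= a -> 0 < eps -> H a < h eps -> a < eps)
    (phi : R -> nat -> nat)
    (phi_bound : forall (eps : R) (n : nat), 0 < eps ->
      exists t : R, n%:R <= t <= (phi eps n)%:R /\ (F (x t) < eps%:E)%E)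
    (e : R -> R -> R)
    (quasi_fejer : forall y : X, zer F y -> forall s t : R, 0 <= s -> s <= t ->
      H (mdist (x t) y) <= G (mdist (x s) y) + e s t)
    (eta : R -> (nat -> nat) -> nat) (e_metastable : metastability_rate e eta)
    (eps : R) (f : nat -> nat) : 0 < eps ->
  exists n : nat, exists y : X,
    [/\ (n <= rho g h tau phi eta eps f)%N, zer F y &
        forall t : R, n%:R <= t <= (n + f n)%:R -> mdist (x t) y < eps].
Proof.
move=> eps_gt0; have delta2_gt0 : 0 < h eps / 2 by rewrite divr_gt0 ?h_gt0.
have [tau_gt0 tau_regular] := tau_modulus.
have [n0 n0_le e_small] :=
  e_metastable _ (f_phi g tau phi f (h eps)) delta2_gt0.
have [t0 [/andP[n0_le_t0 t0_le_phi] Ft0]] :=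
  phi_bound _ n0 (tau_gt0 _ (g_gt0 _ delta2_gt0)).
have t0_ge0 : 0 <= t0 by rewrite (le_trans _ n0_le_t0).
have xt0_ball : cball z b (x t0) by rewrite /cball/= metric_sym x_bounded.
have /dist_ltP[y y_zer xt0_y] :=
  tau_regular _ (g_gt0 _ delta2_gt0) _ xt0_ball Ft0.
have /andP[m_le_t0 t0_lt_m] := truncn_itv t0_ge0.
set m := Num.truncn t0 in m_le_t0 t0_lt_m.
have m_le_phi : (m <= phi (tau (g (h eps / 2))) n0)%N.
  by rewrite -(ler_nat R) (le_trans m_le_t0).
exists m.+1, y; split=> //; first exact: leq_ltn_trans (phi_lt_rho n0_le).
move=> t /andP[m_lt_t t_le].
have t0_le_t : t0 <= t := le_trans (ltW t0_lt_m) m_lt_t.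
have e_lt : e t0 t < h eps / 2.
  apply: le_lt_trans (ler_norm _) _; apply: e_small => //.
  by rewrite (le_trans t_le)// ler_nat leq_f_phi.
apply: H_modulus; rewrite ?mdist_ge0//.
apply: le_lt_trans (quasi_fejer _ y_zer _ _ t0_ge0 t0_le_t) _.
by rewrite [ltRHS]splitr ltrD// G_modulus// mdist_ge0.
Qed.

Theorem theorem3p17 (R : realType) (X : metricType R)
    (F : X -> \bar R) (F_ge0 : forall u : X, (0 <= F u)%E)
    (x : R -> X) (z : X) (b : R)
    (z_zer : zer F z) (b_gt0 : 0 < b)
    (x_bounded : forall t : R, 0 <= t -> mdist (x t) z <= b)
    (tau : R -> R) (tau_modulus : modulus_of_regularity F z b tau)
    (G H g h : R -> R)
    (G_ge0 : forall a : R, 0 <= a -> 0 <= G a)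
    (H_ge0 : forall a : R, 0 <= a -> 0 <= H a)
    (g_gt0 : forall eps : R, 0 < eps -> 0 < g eps)
    (h_gt0 : forall eps : R, 0 < eps -> 0 < h eps)
    (G_modulus : forall a eps : R, 0 <= a -> 0 < eps -> a < g eps -> G a < eps)
    (H_modulus : forall a eps : R, 0 <= a -> 0 < eps -> H a < h eps -> a < eps)
    (phi : R -> nat -> nat)
    (phi_bound : forall (eps : R) (n : nat), 0 < eps ->
      exists t : R, n%:R <= t <= (phi eps n)%:R /\ (F (x t) < eps%:E)%E)
    (e : R -> R -> R)
    (quasi_fejer : forall y : X, zer F y -> forall s t : R, 0 <= s -> s <= t ->
      H (mdist (x t) y) <= G (mdist (x s) y) + e s t)
    (eta : R -> (nat -> nat) -> nat) (e_metastable : metastability_rate e eta) :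
  (forall (eps : R) (f : nat -> nat), 0 < eps ->
    exists2 n : nat, (n <= rho g h tau phi eta eps f)%N &
      forall t : R, n%:R <= t <= (n + f n)%:R ->
        (dist (x t) (zer F) < eps%:E)%E) /\
  (forall (eps : R) (f : nat -> nat), 0 < eps ->
    exists2 n : nat, (n <= rho g h tau phi eta (eps / 2) f)%N &
      forall s t : R, n%:R <= s <= (n + f n)%:R -> n%:R <= t <= (n + f n)%:R ->
        mdist (x t) (x s) < eps).
Proof.
have near_zer := exists_zer_near_window x_bounded tau_modulus g_gt0 h_gt0
  G_modulus H_modulus phi_bound quasi_fejer e_metastable.
split=> eps f eps_gt0.
  have [n [y [n_le y_zer xy]]] := near_zer _ f eps_gt0.
  by exists n => // t /xy ?; apply/dist_ltP; exists y.
have eps2_gt0 : 0 < eps / 2 by rewrite divr_gt0.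
have [n [y [n_le _ xy]]] := near_zer _ f eps2_gt0.
exists n => // s t /xy xs_y /xy xt_y.
rewrite (le_lt_trans (metric_triangle _ y _))// [ltRHS]splitr ltrD//.
by rewrite metric_sym.
Qed.
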